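(* Let $r=1$ and use the cosine basis $\psi_0=1$, $\psi_j(x)=\sqrt2\cos(\pi jx)$, $j\ge1$, of $L_2(0,1)$ (so $c_0=\sup_j\sup_x|\psi_j(x)|=\sqrt2$). Let $\gamma>1$, $C>0$, and let $X_1,\dots,X_n$ be i.i.d. with density $p=1+\sum_{j\ge1}\beta_j\psi_j\in\mathcal P(\gamma,C)$. Let $m_n=\lfloor n^{1/(2\gamma+1)}\rfloor$, $k\asymp\sqrt n$, $m_k=\lfloor k^{1/(2\gamma+1)}\rfloor$, and define $\hat p(x)=1+\sum_{j=1}^{m_n}\hat\beta_j\psi_j(x)$ with $\hat\beta_j=n^{-1}\sum_{i=1}^n\psi_j(X_i)$, and for $z\in[0,1]^k$, $\hat p^*_z(x)=1+\sum_{j=1}^{m_k}\hat\beta^*_j\psi_j(x)$ with $\hat\beta^*_j=k^{-1}\sum_{i=1}^k\psi_j(z_i)$. Let $Z=(Z_1,\dots,Z_k)$ be drawn from the density on $[0,1]^k$ proportional to $\exp\big(-\alpha\,\xi(X,z)/(2\Delta)\big)$, where $\xi(X,z)=\|\hat p-\hat p^*_z\|_{\ell_2}$ and $\Delta=2c_0^2m_n/n$, and set $\hat p^*=\hat p^*_Z$. Then $$\int_0^1(p(x)-\hat p^*(x))^2dx=O_P\big(n^{-\gamma/(2\gamma+1)}\big).$$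
   Context: For $u\in L_2(0,1)$, $\|u\|_{\ell_2}=(\int_0^1|u(x)|^2dx)^{1/2}$. Sobolev class: for $\gamma>1/2$, $C>0$, $\mathcal B(\gamma,C)=\{\beta=(\beta_1,\beta_2,\dots):\sum_{j\ge1}\beta_j^2j^{2\gamma}\le C^2\}$ and $\mathcal P(\gamma,C)=\{p=1+\sum_{j\ge1}\beta_j\psi_j:\beta\in\mathcal B(\gamma,C)\}$ (densities on $[0,1]$). $a_n\asymp b_n$ means $a_n/b_n$ and $b_n/a_n$ are bounded for large $n$; $\alpha>0$ is fixed; $O_P$ refers to the joint law of $X$ and $Z$. *)

(* Defs.v *)
From HB Require Import structures.
From mathcomp Require Import all_boot all_order all_algebra.
From mathcomp Require Import all_classical all_reals all_analysis.
Set Implicit Arguments. Unset Strict Implicit. Unset Printing Implicit Defensive.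
Import Order.TTheory GRing.Theory Num.Theory.
Import numFieldNormedType.Exports.
Local Open Scope classical_set_scope.
Local Open Scope ring_scope.

Section Defs.
Variable R : realType.

Definition psi (j : nat) (x : R) : R :=
  if j == 0%N then 1 else Num.sqrt 2 * cos (pi * j%:R * x).

(* c_0 = sup_j sup_x |psi_j x| = sqrt 2 *)
Definition c0 : R := Num.sqrt 2.

(* Sobolev ellipsoid B(gamma, C); beta is indexed from 1 (beta 0 unused) *)
Definition in_sobolev (gamma C : R) (beta : nat -> R) : Prop :=
  (\sum_(1 <= j <oo) ((beta j) ^+ 2 * (j%:R `^ (2 * gamma)))%:E <= (C ^+ 2)%:E)%E.

Definition dens (beta : nat -> R) (x : R) : R :=
  1 + limn (fun N => \sum_(1 <= j < N) beta j * psi j x).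

Definition mtrunc (gamma : R) (n : nat) : nat :=
  Num.truncn (n%:R `^ (1 / (2 * gamma + 1))).

Definition hbeta (n : nat) (X : nat -> R) (j : nat) : R :=
  n%:R^-1 * \sum_(i < n) psi j (X i).

Definition phat (gamma : R) (n : nat) (X : nat -> R) (x : R) : R :=
  1 + \sum_(1 <= j < (mtrunc gamma n).+1) hbeta n X j * psi j x.

Definition lebI : set R := `[0, 1].

Definition L2sq (f g : R -> R) : R :=
  Rintegral lebesgue_measure lebI (fun t => (f t - g t) ^+ 2).
Definition L2dist (f g : R -> R) : R := Num.sqrt (L2sq f g).

Definition xi (gamma : R) (n k : nat) (X z : nat -> R) : R :=
  L2dist (phat gamma n X) (phat gamma k z).

Definition Delta (gamma : R) (n : nat) : R :=
  2 * c0 ^+ 2 * (mtrunc gamma n)%:R / n%:R.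

Definition gibbs_w (alpha gamma : R) (n k : nat) (X z : nat -> R) : R :=
  expR (- (alpha * xi gamma n k X z / (2 * Delta gamma n))).

(* iterated integral over [0,1]^n (coordinates 0..n-1; others set to 0) *)
Fixpoint iter_int (n : nat) (f : (nat -> R) -> \bar R) : \bar R :=
  match n with
  | 0 => f (fun _ => 0)
  | n'.+1 => (\int[lebesgue_measure]_(t in lebI)
                iter_int n' (fun x => f (fun i => if i is i'.+1 then x i' else t)))%E
  end.

Definition gibbs_Z (alpha gamma : R) (n k : nat) (X : nat -> R) : \bar R :=
  iter_int k (fun z => (gibbs_w alpha gamma n k X z)%:E).

(* joint probability, under X_1..X_n iid with density p on [0,1] and
   Z | X with density proportional to gibbs_w on [0,1]^k, of the event A *)
Definition joint_prob (p : R -> R) (alpha gamma : R) (n k : nat)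
    (A : (nat -> R) -> (nat -> R) -> Prop) : \bar R :=
  iter_int n (fun X =>
    ((\prod_(i < n) p (X i))%:E *
     iter_int k (fun z =>
       ((\1_[set zz | A X zz] z * gibbs_w alpha gamma n k X z)%:E))
     / gibbs_Z alpha gamma n k X)%E).

End Defs.

(* Main.v *)
(** On a set of X of large probability, hat p is within the rate r of p, and so
    is the estimator computed from k draws from p, on average. Since p is bounded by
    a constant B, Lebesgue measure on [0,1]^k dominates B^-k times the law of k
    draws from p, so the Gibbs normalising constant is at least
    B^-k e^(-lam r) / 2, where lam = alpha / (2 Delta); the samples z at distance
    more than 2r from hat p have total weight at most e^(-2 lam r). The conditional
    probability of a large error is thus at most 2 B^k e^(-lam r), and it is
    negligible because lam r is at least of order sqrt n, which is the order of k:
    this is where gamma >= 1 enters. *)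
Require Import Defs.
From HB Require Import structures.
From mathcomp Require Import all_boot all_order all_algebra.
From mathcomp Require Import all_classical all_reals all_analysis.
From mathcomp Require Import ring lra.
Import Order.TTheory GRing.Theory Num.Theory.
Import numFieldNormedType.Exports.
Local Open Scope classical_set_scope.
Local Open Scope ring_scope.

(** * Integrals of continuous functions over [0,1] *)

Section UnitIntegral.
Variable R : realType.
Implicit Types f g : R -> R.

Local Notation D := (@lebI R).
Local Notation "\I f" := (Rintegral lebesgue_measure D f) (at level 10, f at level 9).

Lemma continuous_integrable_lebI f : continuous f ->
  lebesgue_measure.-integrable D (EFin \o f).
Proof.
move=> cf; apply: continuous_compact_integrable; first exact: segment_compact.
exact: continuous_subspaceT.
Qed.

Lemma integral_lebI f : continuous f ->
  (\int[lebesgue_measure]_(t in D) (f t)%:E = (\I f)%:E)%E.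
Proof.
move=> cf; rewrite /Rintegral fineK//.
apply: (integrable_fin_num _ (continuous_integrable_lebI _ cf)).
exact: measurable_itv.
Qed.

Lemma Rintegral_lebI_cst (c : R) : \I (fun=> c) = c.
Proof.
rewrite Rintegral_cst; last exact: measurable_itv.
transitivity (c * fine (1%:E : \bar R)); last by rewrite mulr1.
congr (_ * fine _); rewrite /lebI; apply: (eq_trans (lebesgue_measure_itv _)).
by rewrite /= lte_fin ltr01 oppr0 adde0.
Qed.

Lemma RintegralD_lebI f g : continuous f -> continuous g ->
  \I (fun x => f x + g x) = \I f + \I g.
Proof.
move=> cf cg; apply: RintegralD; first exact: measurable_itv.
- exact: continuous_integrable_lebI.
- exact: continuous_integrable_lebI.
Qed.

Lemma RintegralZ_lebI (c : R) f : continuous f ->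
  \I (fun x => c * f x) = c * \I f.
Proof.
move=> cf; apply: RintegralZl; first exact: measurable_itv.
exact: continuous_integrable_lebI.
Qed.

Lemma le_Rintegral_lebI f g : continuous f -> continuous g ->
  (forall x, 0 <= x <= 1 -> f x <= g x) -> \I f <= \I g.
Proof.
move=> cf cg fg; apply: le_Rintegral; first exact: measurable_itv.
- exact: continuous_integrable_lebI.
- exact: continuous_integrable_lebI.
- by move=> x; rewrite /lebI/= in_itv/=; exact: fg.
Qed.

Lemma Rintegral_norm_le_lebI (f : R -> R) (e : R) : continuous f ->
  (forall x, 0 <= x <= 1 -> `|f x| <= e) -> `|\I f| <= e.
Proof.
move=> cf fe; have cc (k : R) : continuous (fun _ : R => k) by move=> x; exact: cvg_cst.
rewrite ler_norml; apply/andP; split.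
  rewrite -[leLHS](Rintegral_lebI_cst _); apply: le_Rintegral_lebI => // x /fe.
  by rewrite ler_norml => /andP[].
rewrite -[leRHS](Rintegral_lebI_cst _); apply: le_Rintegral_lebI => // x /fe.
by rewrite ler_norml => /andP[].
Qed.

Lemma continuous_sum (I : Type) (r : seq I) (F : I -> R -> R) :
  (forall i, continuous (F i)) -> continuous (fun x => \sum_(i <- r) F i x).
Proof.
move=> cF; elim: r => [|i r IH].
  rewrite (_ : (fun x => _) = fun=> 0); first by move=> x; exact: cvg_cst.
  by apply/funext => x; rewrite big_nil.
rewrite (_ : (fun x => _) = fun x => F i x + \sum_(i <- r) F i x).
  by move=> x; apply: cvgD; [exact: cF|exact: IH].
by apply/funext => x; rewrite big_cons.
Qed.

Lemma continuousD_fun f g : continuous f -> continuous g ->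
  continuous (fun x => f x + g x).
Proof. by move=> cf cg x; apply: cvgD; [exact: cf|exact: cg]. Qed.

Lemma continuousB_fun f g : continuous f -> continuous g ->
  continuous (fun x => f x - g x).
Proof. by move=> cf cg x; apply: cvgB; [exact: cf|exact: cg]. Qed.

Lemma continuousM_fun f g : continuous f -> continuous g ->
  continuous (fun x => f x * g x).
Proof. by move=> cf cg x; apply: cvgM; [exact: cf|exact: cg]. Qed.

Lemma continuousX2_fun f : continuous f -> continuous (fun x => f x ^+ 2).
Proof. by move=> cf; apply: continuousM_fun. Qed.

Lemma Rintegral_sum_lebI (I : Type) (r : seq I) (F : I -> R -> R) :
  (forall i, continuous (F i)) ->
  \I (fun x => \sum_(i <- r) F i x) = \sum_(i <- r) \I (F i).
Proof.
move=> cF; elim: r => [|i r IH].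
  under eq_fun do rewrite big_nil.
  by rewrite big_nil Rintegral_lebI_cst.
under eq_fun do rewrite big_cons.
rewrite big_cons RintegralD_lebI ?IH//; exact: continuous_sum.
Qed.

(* No measurability is assumed, so the event and the Gibbs weight need not be
   shown to be measurable. *)
Lemma le_integral_nonmeas (f g : R -> \bar R) :
  (forall x, 0 <= x <= 1 -> (f x <= g x)%E) ->
  (\int[lebesgue_measure]_(t in D) f t <= \int[lebesgue_measure]_(t in D) g t)%E.
Proof.
move=> fg; have fgD x : ((f \_ D) x <= (g \_ D) x)%E.
  rewrite /patch; case: ifPn => //; rewrite inE /lebI/= in_itv/=; exact: fg.
(* The integral is a difference of two suprema over simple functions lying below the positive and
   negative parts, so comparing the families of simple functions is enough. *)
rewrite /integral; apply: leeB; apply: le_ereal_sup => _ [h /= hf <-];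
  exists h => //= x; apply: (le_trans (hf x)).
- by rewrite !funeposE ge_max !le_max fgD/= lexx orbT.
- by rewrite !funenegE ge_max !le_max leeN2 fgD/= lexx orbT.
Qed.

(** The antiderivative [sin (a * x) / a] vanishes at both ends, because the sine of an integer
    multiple of [pi] is 0. *)
Lemma cos_mul_natpi_integral (j : nat) : (0 < j)%N ->
  \I (fun x => cos (pi * j%:R * x)) = 0 :> R.
Proof.
move=> j0; set a : R := pi * j%:R.
have a0 : a != 0 by rewrite mulf_neq0// ?gt_eqF ?pi_gt0 ?ltr0n.
have ca : continuous (fun x : R => cos (a * x)).
  move=> x; apply: continuous_comp; last exact: continuous_cos.
  by apply: cvgM; [exact: cvg_cst|exact: cvg_id].
pose F x : R := a^-1 * sin (a * x).
have dF (x : R) : is_derive x 1 F (cos (a * x)).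
  apply: is_derive_eq; rewrite /GRing.scale/=.
  by field.
have cF : continuous F.
  by move=> x; apply: differentiable_continuous; apply/derivable1_diffP;
     have [] := dF x.
have := @continuous_FTC2 R (fun x => cos (a * x)) F 0 1 ltr01.
rewrite -/D => H.
apply: EFin_inj; rewrite -integral_lebI// H.
- rewrite -EFinB /F mulr0 sin0 mulr0 subr0 mulr1; congr EFin.
  rewrite [sin a](_ : _ = 0) ?mulr0// /a.
  elim: j {j0 a a0 ca F dF cF H} => [|j IH]; first by rewrite mulr0 sin0.
  by rewrite -natr1 mulrDr mulr1 sinDpi IH oppr0.
- exact: continuous_subspaceT.
- split => [x _||]; first by have [] := dF x.
  + exact/cvg_at_right_filter/cF.
  + exact/cvg_at_left_filter/cF.
- by move=> x _; rewrite derive1E; have [] := dF x.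
Qed.
End UnitIntegral.

(** * Orthonormality of the cosine basis and Parseval's identity for finite sums *)

Section CosineBasis.
Variable R : realType.
Local Notation "\I f" := (Rintegral lebesgue_measure (@lebI R) f) (at level 10, f at level 9).

Lemma continuous_psi j : continuous (@psi R j).
Proof.
move=> x; rewrite /psi; case: eqP => _; first exact: cvg_cst.
apply: cvgM; first exact: cvg_cst.
apply: continuous_comp; last exact: continuous_cos.
by apply: cvgM; [exact: cvg_cst|exact: cvg_id].
Qed.

Lemma psi_sqr_le2 j (x : R) : psi j x ^+ 2 <= 2.
Proof.
rewrite /psi; case: eqP => _; first by rewrite expr1n ler1n.
by rewrite exprMn sqr_sqrtr ?ler0n// -[leRHS]mulr1 ler_wpM2l// ?ler0n//.
Qed.

Lemma normr_psi_le j (x : R) : `|psi j x| <= Num.sqrt 2.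
Proof. by rewrite -sqrtr_sqr ler_sqrt ?ler0n// psi_sqr_le2. Qed.

Let cosM (a b : R) : 2 * (cos a * cos b) = cos (a - b) + cos (a + b).
Proof. by rewrite cosB cosD; ring. Qed.

Lemma continuous_cosM (a : R) : continuous (fun x : R => cos (a * x)).
Proof.
move=> x; apply: continuous_comp; last exact: continuous_cos.
by apply: cvgM; [exact: cvg_cst|exact: cvg_id].
Qed.

(** The product-to-sum formula leaves cosines of frequencies [i - j] and [i + j], and only frequency
    0 has a nonzero integral. Index 0 is handled apart because [psi 0] lacks the factor [sqrt 2]. *)
Lemma psi_orthonormal i j :
  \I (fun x => psi i x * psi j x) = (i == j)%:R :> R.
Proof.
have int0 k : (0 < k)%N -> \I (@psi R k) = 0.
  move=> k0; rewrite /psi gtn_eqF// RintegralZ_lebI; last exact: continuous_cosM.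
  by rewrite cos_mul_natpi_integral// mulr0.
have [->|i0] := posnP i.
  rewrite (_ : (fun x => _) = psi j); last first.
    by apply/funext => x; rewrite {1}/psi eqxx mul1r.
  have [->|j0] := posnP j; last by rewrite int0// ltn_eqF.
  by rewrite /psi eqxx Rintegral_lebI_cst.
have [->|j0] := posnP j.
  rewrite (_ : (fun x => _) = psi i); last first.
    by apply/funext => x; rewrite {2}/psi eqxx mulr1.
  by rewrite int0// gtn_eqF.
(* By symmetry the truncated subtraction [i - j] may be taken to be exact. *)
wlog ij : i j i0 j0 / (j <= i)%N.
  move=> H; case: (leqP j i) => ij; first exact: H.
  by rewrite eq_sym -H//; [congr Rintegral; apply/funext => x; rewrite mulrC|exact: ltnW].
transitivity (\I (fun x : R => cos (pi * (i - j)%:R * x) + cos (pi * (i + j)%:R * x))).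
  congr Rintegral; apply/funext => x; rewrite /psi !gtn_eqF//.
  rewrite mulrACA -expr2 sqr_sqrtr ?ler0n// cosM natrB// natrD.
  by congr (cos _ + cos _); ring.
rewrite RintegralD_lebI; [|exact: continuous_cosM|exact: continuous_cosM].
rewrite (cos_mul_natpi_integral _ (i + j))// ?addn_gt0 ?i0// addr0.
have [->|ne] := eqVneq i j.
  rewrite subnn (_ : (fun x => _) = fun=> 1) ?Rintegral_lebI_cst//.
  by apply/funext => x; rewrite mulr0 mul0r cos0.
by rewrite cos_mul_natpi_integral// subn_gt0 ltn_neqAle eq_sym ne.
Qed.

Lemma continuous_psi_sum (r : seq nat) (d : nat -> R) :
  continuous (fun x => \sum_(j <- r) d j * psi j x).
Proof.
apply: (@continuous_sum R nat r (fun j x => d j * psi j x)) => j.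
by apply: continuousM_fun; [move=> x; exact: cvg_cst|exact: continuous_psi].
Qed.

Lemma continuous_trig m (b : nat -> R) :
  continuous (fun x => 1 + \sum_(1 <= j < m) b j * psi j x).
Proof.
by apply: continuousD_fun; [move=> x; exact: cvg_cst|exact: continuous_psi_sum].
Qed.

Lemma Rintegral_psi_sum_psi (r : seq nat) (d : nat -> R) i : uniq r ->
  \I (fun x => (\sum_(j <- r) d j * psi j x) * psi i x) = (i \in r)%:R * d i.
Proof.
move=> ur; transitivity (\I (fun x => \sum_(j <- r) d j * (psi j x * psi i x))).
  congr Rintegral; apply/funext => x; rewrite mulr_suml.
  by apply: eq_bigr => j _; rewrite mulrA.
have cpp j : continuous (fun x : R => psi j x * psi i x).
  by apply: continuousM_fun; exact: continuous_psi.
rewrite (@Rintegral_sum_lebI R nat r (fun j x => d j * (psi j x * psi i x))); last first.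
  by move=> j; apply: continuousM_fun => // x; exact: cvg_cst.
under eq_bigr do rewrite RintegralZ_lebI// psi_orthonormal.
have [ir|ir] := boolP (i \in r).
  rewrite (bigD1_seq i)//= eqxx mulr1 mul1r big1 ?addr0// => j /negbTE ->.
  by rewrite mulr0.
rewrite mul0r big_seq big1// => j jr; rewrite (_ : j == i = false) ?mulr0//.
by apply: contraNF ir => /eqP <-.
Qed.

(** One factor of the square is expanded; each inner product with [psi j] then reads off the
    coefficient [d j]. *)
Lemma Parseval_psi_sum (r : seq nat) (d : nat -> R) : uniq r ->
  \I (fun x => (\sum_(j <- r) d j * psi j x) ^+ 2) = \sum_(j <- r) d j ^+ 2.
Proof.
move=> ur; pose f x := \sum_(j <- r) d j * psi j x.
transitivity (\I (fun x => \sum_(j <- r) d j * (f x * psi j x))).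
  congr Rintegral; apply/funext => x; rewrite expr2 mulr_sumr.
  by apply: eq_bigr => j _; rewrite mulrCA.
have cfp j : continuous (fun x : R => f x * psi j x).
  by apply: continuousM_fun; [exact: continuous_psi_sum|exact: continuous_psi].
rewrite (@Rintegral_sum_lebI R nat r (fun j x => d j * (f x * psi j x))); last first.
  by move=> j; apply: continuousM_fun => // x; exact: cvg_cst.
rewrite big_seq [RHS]big_seq; apply: eq_bigr => j jr.
by rewrite RintegralZ_lebI// Rintegral_psi_sum_psi// jr mul1r expr2.
Qed.

End CosineBasis.

(** * The squared distance in the space of square-integrable functions *)

Section L2sqTheory.
Variable R : realType.
Implicit Types f g h : R -> R.

Lemma L2sq_ge0 f g : 0 <= L2sq f g.
Proof. by apply: Rintegral_ge0 => x _; exact: sqr_ge0. Qed.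

Lemma L2distK f g : L2dist f g ^+ 2 = L2sq f g.
Proof. by rewrite sqr_sqrtr// L2sq_ge0. Qed.

Lemma L2sq_sym f g : L2sq f g = L2sq g f.
Proof. by congr Rintegral; apply/funext => x; ring. Qed.

(** A substitute for the triangle inequality that stays with squares: pointwise, the defect is the
    square of [(f - g) - (g - h)]. *)
Lemma L2sq_le2D f g h : continuous f -> continuous g -> continuous h ->
  L2sq f h <= 2 * L2sq f g + 2 * L2sq g h.
Proof.
move=> cf cg ch.
have csq (u v : R -> R) : continuous u -> continuous v ->
    continuous (fun x => (u x - v x) ^+ 2).
  by move=> cu cv; apply: continuousX2_fun; exact: continuousB_fun.
have c2 (u v : R -> R) : continuous u -> continuous v ->
    continuous (fun x => 2 * (u x - v x) ^+ 2).
  by move=> cu cv; apply: continuousM_fun; [move=> x; exact: cvg_cst|exact: csq].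
rewrite /L2sq -!RintegralZ_lebI; [|exact: csq|exact: csq].
rewrite -RintegralD_lebI; [|exact: c2|exact: c2].
apply: le_Rintegral_lebI; first exact: csq.
  by apply: continuousD_fun; exact: c2.
move=> x _; have := sqr_ge0 (f x - g x - (g x - h x)); lra.
Qed.

Lemma L2sq_le f g (e : R) : continuous f -> continuous g ->
  (forall x, 0 <= x <= 1 -> `|f x - g x| <= e) -> L2sq f g <= e ^+ 2.
Proof.
move=> cf cg fge; rewrite -[leRHS](@Rintegral_lebI_cst R).
apply: le_Rintegral_lebI => [| |x /fge fgx].
- by apply: continuousX2_fun; exact: continuousB_fun.
- by move=> x; exact: cvg_cst.
- by rewrite -real_normK ?num_real//; apply: lerXn2r;
  rewrite ?nnegrE//; exact: le_trans fgx.
Qed.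

End L2sqTheory.

(** * Iterated integrals over the cube and second moments of sums of independent centred terms *)

Section IteratedIntegral.
Variable R : realType.

Let scons (t : R) (x : nat -> R) : nat -> R :=
  fun i => if i is i'.+1 then x i' else t.

Lemma iter_int_le n (f g : (nat -> R) -> \bar R) :
  (forall x, (forall i, 0 <= x i <= 1) -> (f x <= g x)%E) ->
  (iter_int n f <= iter_int n g)%E.
Proof.
elim: n f g => [|n IH] f g fg /=.
  (* Coordinates beyond the last take the default value 0, which lies in [0,1]. *)
  by apply: fg => _; rewrite lexx ler01.
apply: le_integral_nonmeas => t t01; apply: IH => x x01.
by apply: fg => -[|i].
Qed.

Lemma iter_int_cst n (c : R) : iter_int n (fun=> c%:E) = c%:E.
Proof.
elim: n => //= n ->.
rewrite (@integral_lebI R (fun=> c)) ?Rintegral_lebI_cst// => x; exact: cvg_cst.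
Qed.

Variables (p : R -> R) (h : nat -> R -> R) (v : nat -> R) (r : seq nat).
Local Notation "\I f" := (Rintegral lebesgue_measure (@lebI R) f) (at level 10, f at level 9).
Hypotheses (cp : continuous p) (ch : forall j, continuous (h j)).
Hypotheses (p1 : \I p = 1) (ph0 : forall j, j \in r -> \I (fun x => p x * h j x) = 0)
  (phv : forall j, \I (fun x => p x * h j x ^+ 2) = v j).

(* K and c are arbitrary so that the induction can absorb the factor p t and the
   summands h j t contributed by the first coordinate. *)
Lemma iter_int_sum_sqr n (K a b : R) (c : nat -> R) :
  iter_int n (fun x => (K * (\prod_(i < n) p (x i)) *
     (a + b * \sum_(j <- r) (c j + \sum_(i < n) h j (x i)) ^+ 2))%:E)
  = (K * (a + b * \sum_(j <- r) (c j ^+ 2 + n%:R * v j)))%:E.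
Proof.
elim: n K c => [|n IH] K c /=.
  rewrite big_ord0 mulr1; congr (_ * (_ + _ * _))%:E.
  by apply: eq_bigr => j _; rewrite big_ord0 addr0 mul0r addr0.
transitivity (\int[lebesgue_measure]_(t in @lebI R)
   ((K * p t) * (a + b * \sum_(j <- r) ((c j + h j t) ^+ 2 + n%:R * v j)))%:E)%E.
  apply: eq_integral => t _; rewrite -IH; congr (iter_int n _).
  apply/funext => x; congr (_%:E); rewrite big_ord_recl !mulrA.
  congr (_ * (_ + _ * _)); apply: eq_bigr => j _.
  by rewrite big_ord_recl addrA.
have cc (k : R) : continuous (fun _ : R => k) by move=> x; exact: cvg_cst.
(* [F j t] is [p t] times the increase from [c j ^+ 2] to [(c j + h j t) ^+ 2]. *)
pose F j t := 2 * c j * (p t * h j t) + p t * h j t ^+ 2.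
have cF j : continuous (F j).
  apply: continuousD_fun; apply: continuousM_fun => //.
    exact: continuousM_fun.
  exact: continuousX2_fun.
have cS : continuous (fun t => \sum_(j <- r) F j t) by exact: continuous_sum.
pose e := K * (a + b * \sum_(j <- r) (c j ^+ 2 + n%:R * v j)).
transitivity (\int[lebesgue_measure]_(t in @lebI R)
   (e * p t + K * b * \sum_(j <- r) F j t)%:E)%E.
  apply: eq_integral => t _; congr (_%:E); rewrite /e.
  have -> : \sum_(j <- r) ((c j + h j t) ^+ 2 + n%:R * v j) =
    \sum_(j <- r) (c j ^+ 2 + n%:R * v j) + \sum_(j <- r) (2 * c j * h j t + h j t ^+ 2).
    by rewrite -big_split/=; apply: eq_bigr => j _; ring.
  have -> : \sum_(j <- r) F j t = p t * \sum_(j <- r) (2 * c j * h j t + h j t ^+ 2).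
    by rewrite mulr_sumr; apply: eq_bigr => j _; rewrite /F; ring.
  by ring.
rewrite integral_lebI; last first.
  by apply: continuousD_fun; exact: continuousM_fun.
congr (_%:E); rewrite RintegralD_lebI; [|exact: continuousM_fun|exact: continuousM_fun].
rewrite !RintegralZ_lebI// p1 Rintegral_sum_lebI// mulr1.
(* The cross terms vanish by the centring hypothesis [ph0], so each new coordinate contributes [v j]
   alone: variances add. *)
have -> : \sum_(j <- r) \I (F j) = \sum_(j <- r) v j.
  rewrite big_seq [RHS]big_seq; apply: eq_bigr => j jr.
  have cph : continuous (fun x => p x * h j x) by exact: continuousM_fun.
  rewrite /F RintegralD_lebI; last first.
  - by apply: continuousM_fun => //; exact: continuousX2_fun.
  - exact: continuousM_fun.
  by rewrite RintegralZ_lebI// ph0// phv mulr0 add0r.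
rewrite /e -mulrA -mulrDr -addrA -mulrDr -big_split/=.
congr (_ * (_ + _ * _)); apply: eq_bigr => j _; rewrite -natr1; ring.
Qed.

End IteratedIntegral.

(** * Analytic properties of a density with Sobolev coefficients *)

Section SobolevDensity.
Variables (R : realType) (gamma C : R) (beta : nat -> R).
Hypotheses (gamma_ge1 : 1 <= gamma) (sob : in_sobolev gamma C beta).
Local Notation "\I f" := (Rintegral lebesgue_measure (@lebI R) f) (at level 10, f at level 9).
Local Notation p := (dens beta).
Local Notation A := ((C ^+ 2 + 2) / 2).

Lemma sobolev_partial_sum N :
  \sum_(1 <= j < N) (beta j) ^+ 2 * (j%:R `^ (2 * gamma)) <= C ^+ 2.
Proof.
rewrite -lee_fin -sumEFin; apply: le_trans sob.
apply: nneseries_lim_ge => j _ _.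
by rewrite lee_fin mulr_ge0 ?sqr_ge0 ?powR_ge0.
Qed.

(** For indices above [m] the Sobolev weight is at least its value at [m.+1]. *)
Lemma sobolev_tail m N :
  \sum_(m.+1 <= j < N) (beta j) ^+ 2 <= C ^+ 2 * (m.+1%:R `^ (- (2 * gamma))).
Proof.
have g0 : 0 <= 2 * gamma by move: gamma_ge1; lra.
rewrite powRN ler_pdivlMr ?powR_gt0 ?ltr0n//.
apply: le_trans (sobolev_partial_sum N).
have [Nm|mN] := leqP N m.+1.
  rewrite big_geq// mul0r sumr_ge0// => j _.
  by rewrite mulr_ge0 ?sqr_ge0 ?powR_ge0.
rewrite [leRHS](@big_cat_nat _ _ _ m.+1)//=; last exact: ltnW.
rewrite -[leLHS]add0r lerD//.
  by rewrite sumr_ge0// => j _; rewrite mulr_ge0 ?sqr_ge0 ?powR_ge0.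
rewrite mulr_suml; apply: ler_sum_nat => j /andP[mj _].
by rewrite ler_wpM2l ?sqr_ge0// ge0_ler_powR ?nnegrE ?ler0n// ler_nat.
Qed.

(** Induction works on the sharper telescoping bound [2 - 1 / N.+1]. *)
Lemma sum_invr_sqr_le2 N : \sum_(1 <= j < N) (j%:R ^+ 2)^-1 <= 2 :> R.
Proof.
case: N => [|[|N]]; [by rewrite big_geq|by rewrite big_geq|].
suff : \sum_(1 <= j < N.+2) (j%:R ^+ 2)^-1 <= 2 - N.+1%:R^-1 :> R.
  by move/le_trans; apply; rewrite gerBl invr_ge0 ler0n.
elim: N => [|N IH]; first by rewrite big_nat1 expr1n invr1; lra.
rewrite big_nat_recr//=; apply: le_trans (lerD IH (lexx _)) _.
set a : R := N.+1%:R; have a0 : 0 < a by rewrite ltr0n.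
have -> : N.+2%:R = a + 1 :> R by rewrite -natr1.
rewrite -subr_ge0.
have -> : 2 - (a + 1)^-1 - (2 - a^-1 + ((a + 1) ^+ 2)^-1) =
  (a * (a + 1) ^+ 2)^-1 by field; rewrite !gt_eqF//; lra.
by rewrite invr_ge0 mulr_ge0 ?sqr_ge0// ltW.
Qed.

Let s N := \sum_(1 <= j < N) `|beta j|.

(** Expanding the square of [|beta j| * j - 1 / j] bounds [2 |beta j|] by
    [beta j ^+ 2 * j ^+ 2 + 1 / j ^+ 2], and [j ^+ 2] is at most the Sobolev weight since
    [gamma >= 1]. Absolute summability is what makes the density continuous and bounded. *)
Lemma sobolev_abs_sum N : s N <= A.
Proof.
suff H : forall j, (1 <= j)%N ->
    `|beta j| <= 2^-1 * (beta j ^+ 2 * (j%:R `^ (2 * gamma)) + (j%:R ^+ 2)^-1).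
  apply: (@le_trans _ _ (\sum_(1 <= j < N)
      2^-1 * (beta j ^+ 2 * (j%:R `^ (2 * gamma)) + (j%:R ^+ 2)^-1))).
    by apply: ler_sum_nat => j /andP[j1 _]; exact: H.
  rewrite -mulr_sumr big_split/=.
  have := sobolev_partial_sum N; have := sum_invr_sqr_le2 N; lra.
move=> j j1; have j0 : 0 < j%:R :> R by rewrite ltr0n.
have jg : j%:R ^+ 2 <= j%:R `^ (2 * gamma) :> R.
  rewrite -powR_mulrn ?ler0n//; apply: ler_powR; first by rewrite ler1n.
  by move: gamma_ge1; lra.
have := ler_wpM2l (sqr_ge0 (beta j)) jg.
have := sqr_ge0 (`|beta j| * j%:R - j%:R^-1).
have -> : (`|beta j| * j%:R - j%:R^-1) ^+ 2 =
   `|beta j| ^+ 2 * j%:R ^+ 2 - 2 * `|beta j| + (j%:R ^+ 2)^-1 by field; rewrite gt_eqF.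
rewrite real_normK ?num_real//; lra.
Qed.

Let nd_s : nondecreasing_seq s.
Proof.
move=> N M NM; rewrite /s; have [N1|N1] := leqP 1 N.
  rewrite [leRHS](@big_cat_nat _ _ _ N)//= lerDl sumr_ge0// => j _.
rewrite [leLHS]big_geq ?sumr_ge0// ltnW//.
Qed.

Let cvg_s : cvgn s.
Proof.
apply: nondecreasing_is_cvgn => //.
by exists A => _ [N _ <-]; exact: sobolev_abs_sum.
Qed.

Let s_lim N : s N <= limn s.
Proof. exact: nondecreasing_cvgn_le. Qed.

Let u x N := \sum_(1 <= j < N) beta j * psi j x.

(** The increments of the cosine series are dominated, uniformly in [x], by those of the scalar
    series [s]: the Weierstrass test in Cauchy form. *)
Let u_incr x N M : (N <= M)%N -> `|u x M - u x N| <= Num.sqrt 2 * (s M - s N).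
Proof.
move=> NM; rewrite /u /s; have [N1|N1] := leqP 1 N; last first.
  have -> : N = 0%N by case: N N1 {NM}.
  rewrite [in X in _ - X]big_geq// [in X in _ * (_ - X)]big_geq// !subr0.
  apply: le_trans (ler_norm_sum _ _ _) _; rewrite mulr_sumr.
  by apply: ler_sum => j _; rewrite normrM mulrC ler_wpM2r// normr_psi_le.
rewrite [in X in X - _](@big_cat_nat _ _ _ N)//= addrAC subrr add0r.
rewrite [in X in _ * (X - _)](@big_cat_nat _ _ _ N)//= addrAC subrr add0r.
apply: le_trans (ler_norm_sum _ _ _) _; rewrite mulr_sumr.
by apply: ler_sum => j _; rewrite normrM mulrC ler_wpM2r// normr_psi_le.
Qed.

(* u x + sqrt 2 * s is monotone and bounded, hence convergent. *)
Let cvg_u x : cvgn (u x).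
Proof.
have -> : u x = (fun N => (u x N + Num.sqrt 2 * s N) - Num.sqrt 2 * s N).
  by apply/funext => N; rewrite addrK.
apply: is_cvgB; last exact: is_cvgZr.
apply: nondecreasing_is_cvgn.
  move=> N M NM; have := u_incr x _ _ NM; rewrite ler_norml => /andP[]; lra.
exists (2 * (Num.sqrt 2 * A)) => _ [N _ <-].
have := u_incr x _ _ (leq0n N); rewrite {2}/u {2}/s !big_geq// !subr0.
rewrite ler_norml => /andP[_ H].
have : Num.sqrt 2 * s N <= Num.sqrt 2 * A by rewrite ler_wpM2l// sobolev_abs_sum.
lra.
Qed.

Let pN N x := 1 + u x N.

Let dens_approx N x : `|p x - pN N x| <= Num.sqrt 2 * (limn s - s N).
Proof.
have H M : (N <= M)%N -> `|u x M - u x N| <= Num.sqrt 2 * (limn s - s N).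
  move=> NM; apply: le_trans (u_incr x _ _ NM) _.
  by rewrite ler_wpM2l// lerB.
rewrite /dens /pN -/(u x) opprD addrACA subrr add0r ler_norml; apply/andP; split.
  rewrite lerBrDl; apply: limr_ge => //; near=> M.
  have /H : (N <= M)%N by near: M; exact: nbhs_infty_ge.
  by rewrite ler_norml => /andP[+ _]; rewrite lerBrDl.
rewrite lerBlDl; apply: limr_le => //; near=> M.
have /H : (N <= M)%N by near: M; exact: nbhs_infty_ge.
by rewrite ler_norml => /andP[_ +]; rewrite lerBlDl.
Unshelve. all: by end_near. Qed.

(** The tail of [s] bounds the truncation error and does not involve [x], so one [N0] serves every
    point. *)
Let dens_uniform (e : R) : 0 < e ->
  exists N0, forall N, (N0 <= N)%N -> forall x, `|p x - pN N x| <= e.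
Proof.
move=> e0; have s20 : 0 < Num.sqrt 2 :> R by rewrite sqrtr_gt0 ltr0n.
have /cvgrPdist_le/(_ (e / Num.sqrt 2)) := cvg_s.
case=> [|N0 _ H]; first exact: divr_gt0.
exists N0 => N /H; rewrite /= ger0_norm ?subr_ge0// => HN x.
apply: le_trans (dens_approx N x) _.
by rewrite mulrC -ler_pdivlMr.
Qed.

Let continuous_pN N : continuous (pN N).
Proof.
by apply: continuousD_fun; [move=> x; exact: cvg_cst|exact: continuous_psi_sum].
Qed.

Lemma continuous_dens : continuous p.
Proof.
move=> x; apply/cvgrPdist_le => e e0.
have e3 : 0 < e / 3 by lra.
have [N /(_ N (leqnn _)) HN] := dens_uniform _ e3.
have /cvgrPdist_le/(_ _ e3) cN := continuous_pN N x.
near=> y.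
have H1 := HN x; have H2 := HN y.
have H3 : `|pN N x - pN N y| <= e / 3 by near: y; exact: cN.
move: H1 H2 H3; rewrite !ler_norml => /andP[? ?] /andP[? ?] /andP[? ?].
by apply/andP; split; lra.
Unshelve. all: by end_near. Qed.

(** The constant term 1 plus the uniform bound on the cosine series; it depends on [C] alone. *)
Definition sobolev_sup : R := 1 + Num.sqrt 2 * A.

Lemma sobolev_sup_ge1 : 1 <= sobolev_sup.
Proof. by rewrite lerDl mulr_ge0// divr_ge0 ?addr_ge0 ?sqr_ge0. Qed.

Lemma dens_le_sup x : p x <= sobolev_sup.
Proof.
rewrite /dens -/(u x) /sobolev_sup lerD2l; apply: limr_le => //; near=> N.
have := u_incr x _ _ (leq0n N); rewrite {2}/u {2}/s !big_geq// !subr0.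
rewrite ler_norml => /andP[_ H]; apply: le_trans H _.
by rewrite ler_wpM2l// sobolev_abs_sum.
Unshelve. all: by end_near. Qed.

Let coef j := if j == 0%N then 1 else beta j.

Let pN_coef N x : (0 < N)%N -> pN N x = \sum_(0 <= j < N) coef j * psi j x.
Proof.
move=> N0; rewrite big_ltn// /coef eqxx mul1r {1}/psi eqxx; congr (_ + _).
by apply: eq_big_nat => -[].
Qed.

(** A truncation beyond [i] already has the exact [i]-th coefficient. The truncation error,
    uniformly at most [e / sqrt 2], is multiplied by a function bounded by [sqrt 2], and [e] is
    arbitrary. *)
Lemma Rintegral_dens_psi i : \I (fun x => p x * psi i x) = if i == 0%N then 1 else beta i.
Proof.
apply/eqP; rewrite -subr_eq0 -normr_le0; apply/ler_addgt0Pl => e e0; rewrite addr0.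
have s20 : 0 < Num.sqrt 2 :> R by rewrite sqrtr_gt0 ltr0n.
have [|N0 HN] := dens_uniform (e / Num.sqrt 2); first exact: divr_gt0.
pose N := maxn N0 i.+1.
have iN : (i < N)%N by rewrite leq_max leqnn orbT.
have cpsi := @continuous_psi R i.
have -> : (if i == 0%N then 1 else beta i) = \I (fun x => pN N x * psi i x).
  transitivity (\I (fun x => (\sum_(0 <= j < N) coef j * psi j x) * psi i x)).
    by rewrite Rintegral_psi_sum_psi ?iota_uniq// mem_index_iota iN mul1r.
  by congr Rintegral; apply/funext => x; rewrite pN_coef// (leq_ltn_trans _ iN).
have -> : \I (fun x => p x * psi i x) = \I (fun x => (p x - pN N x) * psi i x) +
   \I (fun x => pN N x * psi i x).
  rewrite -RintegralD_lebI; last 2 first.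
  - by apply: continuousM_fun => //; apply: continuousB_fun => //; exact: continuous_dens.
  - exact: continuousM_fun.
  by congr Rintegral; apply/funext => x; ring.
rewrite addrK; apply: Rintegral_norm_le_lebI.
  by apply: continuousM_fun => //; apply: continuousB_fun => //; exact: continuous_dens.
move=> x _; rewrite normrM.
have /HN/(_ x) H : (N0 <= N)%N by rewrite leq_maxl.
rewrite -[leRHS](@divfK _ (Num.sqrt 2)) ?gt_eqF//.
by apply: ler_pM => //; exact: normr_psi_le.
Qed.

Lemma Rintegral_dens : \I p = 1.
Proof.
rewrite -[RHS](Rintegral_dens_psi 0); congr Rintegral; apply/funext => x.
by rewrite /psi eqxx mulr1.
Qed.

(** Parseval is applied to a long truncation [pN N] in place of the density: the coefficients of the
    difference are [beta j - b j] up to [m] and [beta j] afterwards. Passing through [pN N] costs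
    the factors 2 and an arbitrarily small [e]. *)
Lemma L2sq_dens_trig m (b : nat -> R) :
  L2sq p (fun x => 1 + \sum_(1 <= j < m.+1) b j * psi j x) <=
  2 * (C ^+ 2 * (m.+1%:R `^ (- (2 * gamma)))) +
  2 * \sum_(1 <= j < m.+1) (beta j - b j) ^+ 2.
Proof.
set q := fun x => _; apply/ler_addgt0Pl => e e0.
pose d := Num.sqrt (e / 2).
have e20 : 0 < e / 2 by lra.
have d0 : 0 < d by rewrite sqrtr_gt0.
have [N0 HN] := dens_uniform _ d0.
pose N := maxn N0 m.+1.
have mN : (m.+1 <= N)%N by rewrite leq_maxr.
apply: le_trans (@L2sq_le2D R _ (pN N) _ continuous_dens (continuous_pN N) (continuous_trig _ _ _)) _.
have H1 : L2sq p (pN N) <= e / 2.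
  rewrite -(sqr_sqrtr (ltW e20)); apply: L2sq_le => //; first exact: continuous_dens.
  by move=> x _; apply: HN; rewrite leq_maxl.
suff H2 : L2sq (pN N) q <= \sum_(1 <= j < m.+1) (beta j - b j) ^+ 2 +
    C ^+ 2 * (m.+1%:R `^ (- (2 * gamma))) by lra.
pose c j := if (j < m.+1)%N then beta j - b j else beta j.
have -> : L2sq (pN N) q = \I (fun x => (\sum_(1 <= j < N) c j * psi j x) ^+ 2).
  congr Rintegral; apply/funext => x; congr (_ ^+ 2); rewrite /pN /q /u.
  rewrite opprD addrACA subrr add0r !(@big_cat_nat _ _ _ m.+1 1 N)//= addrAC.
  congr (_ + _); last first.
    apply: eq_big_nat => j /andP[mj _].
    by rewrite /c ltnNge mj.
  rewrite -sumrB; apply: eq_big_nat => j /andP[_ mj].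
  by rewrite /c mj mulrBl.
rewrite Parseval_psi_sum ?iota_uniq// (@big_cat_nat _ _ _ m.+1 1 N)//= lerD//.
  rewrite le_eqVlt; apply/orP; left; apply/eqP.
  apply: eq_big_nat => j /andP[_ mj].
  by rewrite /c mj.
rewrite (eq_big_nat _ _ (F2 := fun j => beta j ^+ 2)) ?sobolev_tail// => j /andP[mj _].
by rewrite /c ltnNge mj.
Qed.

End SobolevDensity.

(** * Risk of the projection estimator, and the Gibbs conditional probability of a large error *)

Section GibbsSampling.
Variables (R : realType) (gamma C alpha : R) (beta : nat -> R).
Hypotheses (gamma_ge1 : 1 <= gamma) (alpha_ge0 : 0 <= alpha).
Hypothesis sob : in_sobolev gamma C beta.
Hypothesis dens_ge0 : forall x : R, 0 <= x <= 1 -> 0 <= dens beta x.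
Local Notation "\I f" := (Rintegral lebesgue_measure (@lebI R) f) (at level 10, f at level 9).
Local Notation p := (dens beta).
Local Notation B := (sobolev_sup R C).

(** The squared-error rate for a sample of size [n]. The rate of the theorem is this one at sample
    size of order [sqrt n]. *)
Definition rate (n : nat) : R := n%:R `^ (- (2 * gamma / (2 * gamma + 1))).

(** Squared bias plus coefficient errors. Being a sum of squares of empirical means, it can be
    integrated exactly against the law of the sample, unlike the risk with its infinite tail. *)
Definition risk_bound (n : nat) (X : nat -> R) : R :=
  2 * (C ^+ 2 * rate n) +
  2 * \sum_(1 <= j < (mtrunc gamma n).+1) (beta j - hbeta n X j) ^+ 2.

Let continuous_p : continuous p := continuous_dens _ _ _ _ gamma_ge1 sob.

Lemma continuous_phat n X : continuous (phat gamma n X).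
Proof. exact: continuous_trig. Qed.

Lemma mtrunc_le n : (mtrunc gamma n)%:R <= n%:R `^ (1 / (2 * gamma + 1)).
Proof. by rewrite truncn_le powR_ge0. Qed.

Lemma mtrunc_div_le n : (0 < n)%N -> (mtrunc gamma n)%:R / n%:R <= rate n.
Proof.
move=> n0; have n0' : 0 < n%:R :> R by rewrite ltr0n.
rewrite ler_pdivrMr//; apply: le_trans (mtrunc_le n) _.
rewrite /rate -{3}(powRr1 (ltW n0')) -powRD; last first.
  by apply/implyP => _; rewrite gt_eqF.
rewrite le_eqVlt; apply/orP; left; apply/eqP; congr (_ `^ _).
by field; rewrite gt_eqF//; move: gamma_ge1; lra.
Qed.

Lemma mtrunc_tail_le n : (0 < n)%N ->
  (mtrunc gamma n).+1%:R `^ (- (2 * gamma)) <= rate n.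
Proof.
move=> n0; have n0' : 0 < n%:R :> R by rewrite ltr0n.
have -> : rate n = (n%:R `^ (1 / (2 * gamma + 1))) `^ (- (2 * gamma)).
  rewrite -powRrM; congr (_ `^ _).
  by field; rewrite gt_eqF//; move: gamma_ge1; lra.
rewrite !powRN lef_pV2 ?posrE ?powR_gt0 ?ltr0n//.
apply: ge0_ler_powR; rewrite ?nnegrE ?powR_ge0 ?ler0n//.
  by move: gamma_ge1; lra.
by have := truncn_itv (powR_ge0 n%:R (1 / (2 * gamma + 1))) => /andP[_ /ltW].
Qed.

Lemma L2sq_dens_phat n X : (0 < n)%N ->
  L2sq p (phat gamma n X) <= risk_bound n X.
Proof.
move=> n0; apply: le_trans (L2sq_dens_trig _ _ _ _ gamma_ge1 sob _ _) _.
by rewrite lerD2r !ler_wpM2l ?sqr_ge0// mtrunc_tail_le.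
Qed.

(** [V] is the expectation of [risk_bound]. The affine form with free [K], [a], [b] serves twice:
    with [b] negative to bound the Gibbs normalising constant from below, and with [b] positive to
    average over [X]. *)
Lemma iter_int_risk_bound n : (0 < n)%N ->
  exists2 V, V <= 2 * (C ^+ 2 + 2) * rate n & forall K a b,
  iter_int n (fun x => (K * (\prod_(i < n) p (x i)) *
     (a + b * risk_bound n x))%:E) = (K * (a + b * V))%:E.
Proof.
move=> n0; have n0' : 0 < n%:R :> R by rewrite ltr0n.
set m := mtrunc gamma n; pose h j (x : R) := beta j - psi j x.
have ch j : continuous (h j).
  by apply: continuousB_fun; [move=> x; exact: cvg_cst|exact: continuous_psi].
pose v j := \I (fun x => p x * h j x ^+ 2).
have ph0 j : j \in index_iota 1 m.+1 -> \I (fun x => p x * h j x) = 0.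
  rewrite mem_index_iota => /andP[j1 _].
  transitivity (\I (fun x => beta j * p x + (- 1) * (p x * psi j x))).
    by congr Rintegral; apply/funext => x; rewrite /h; ring.
  have cpp : continuous (fun x => p x * psi j x).
    by apply: continuousM_fun => //; exact: continuous_psi.
  have cc (k : R) : continuous (fun _ : R => k) by move=> x; exact: cvg_cst.
  rewrite RintegralD_lebI; [|exact: continuousM_fun|exact: continuousM_fun].
  rewrite !RintegralZ_lebI// (Rintegral_dens _ _ _ _ gamma_ge1 sob).
  by rewrite (Rintegral_dens_psi _ _ _ _ gamma_ge1 sob) gtn_eqF//; ring.
have v_le2 j : j \in index_iota 1 m.+1 -> v j <= 2.
  move=> jm; have := jm; rewrite mem_index_iota => /andP[j1 _].
  have cc (k : R) : continuous (fun _ : R => k) by move=> x; exact: cvg_cst.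
  have cp2 : continuous (fun x => p x * psi j x ^+ 2).
    by apply: continuousM_fun => //; apply: continuousX2_fun; exact: continuous_psi.
  have cph : continuous (fun x => p x * h j x) by exact: continuousM_fun.
  (* The variance is the second moment minus the squared mean; the second moment is at most 2
     because [psi j ^+ 2 <= 2]. *)
  have -> : v j = \I (fun x => p x * psi j x ^+ 2) - beta j ^+ 2.
    have -> : v j = \I (fun x => (p x * psi j x ^+ 2 +
        (2 * beta j) * (p x * h j x)) + (- beta j ^+ 2) * p x).
      by congr Rintegral; apply/funext => x; rewrite /h; ring.
    rewrite RintegralD_lebI; last 2 first.
    - by apply: continuousD_fun => //; exact: continuousM_fun.
    - exact: continuousM_fun.
    rewrite RintegralD_lebI//; last exact: continuousM_fun.
    by rewrite !RintegralZ_lebI// ph0// (Rintegral_dens _ _ _ _ gamma_ge1 sob); ring.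
  rewrite lerBlDr; apply: (@le_trans _ _ 2); last by rewrite lerDl sqr_ge0.
  apply: (@le_trans _ _ (\I (fun x => 2 * p x))); last first.
    by rewrite RintegralZ_lebI// (Rintegral_dens _ _ _ _ gamma_ge1 sob) mulr1.
  apply: le_Rintegral_lebI => //; first exact: continuousM_fun.
  by move=> x /dens_ge0 px; rewrite mulrC ler_wpM2r// psi_sqr_le2.
exists (2 * (C ^+ 2 * rate n) + 2 * (n%:R ^- 2 *
    \sum_(j <- index_iota 1 m.+1) (0 ^+ 2 + n%:R * v j))).
  have H : n%:R ^- 2 * \sum_(j <- index_iota 1 m.+1) (0 ^+ 2 + n%:R * v j) <= 2 * rate n.
    apply: (@le_trans _ _ (2 * (m%:R / n%:R))); last first.
      by rewrite ler_wpM2l// mtrunc_div_le.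
    have -> : 2 * (m%:R / n%:R) = n%:R ^- 2 * (n%:R * (m%:R * 2)) :> R.
      by field; rewrite gt_eqF.
    rewrite ler_wpM2l ?invr_ge0 ?sqr_ge0//.
    under eq_bigr do rewrite expr0n add0r.
    rewrite -mulr_sumr ler_wpM2l ?ler0n// big_seq.
    apply: (@le_trans _ _ (\sum_(j <- index_iota 1 m.+1 | j \in index_iota 1 m.+1) 2)).
      by apply: ler_sum.
    by rewrite -big_seq sumr_const_nat subSS subn0 [leRHS]mulrC mulr_natr.
  by move: H; lra.
(* The bias term is absorbed into the additive constant, and [n ^- 2] arises from writing each
   coefficient error as [1 / n] times a sum of centred terms. *)
move=> K a b; have := iter_int_sum_sqr _ _ _ _ (index_iota 1 m.+1) continuous_p ch
  (Rintegral_dens _ _ _ _ gamma_ge1 sob) ph0 (fun=> erefl) n K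
  (a + b * (2 * (C ^+ 2 * rate n))) (b * 2 * n%:R ^- 2) (fun=> 0).
rewrite -/v => H; transitivity (K * (a + b * (2 * (C ^+ 2 * rate n)) +
   b * 2 * n%:R ^- 2 * \sum_(j <- index_iota 1 m.+1) (0 ^+ 2 + n%:R * v j)))%:E;
  last by congr (_%:E); ring.
rewrite -H; congr (iter_int n _); apply/funext => x; congr (_%:E); congr (_ * _).
rewrite /risk_bound -/m mulrDr addrA; congr (_ + _).
rewrite -!mulrA; congr (_ * (_ * _)); rewrite mulr_sumr; apply: eq_bigr => j _.
rewrite add0r /h sumrB sumr_const card_ord /hbeta -[beta j *+ n]mulr_natr.
by field; rewrite gt_eqF.
Qed.

Variables (n k : nat) (r : R).
Hypotheses (n_gt0 : (0 < n)%N) (k_gt0 : (0 < k)%N) (r_gt0 : 0 < r).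
Local Notation lam := (alpha / (2 * Delta gamma n)).

Let lam_ge0 : 0 <= lam.
Proof.
apply: divr_ge0 => //; rewrite /Delta !mulr_ge0 ?invr_ge0 ?ler0n//.
all: exact: sqrtr_ge0.
Qed.

Let xi_ge0 X z : 0 <= xi gamma n k X z. Proof. exact: sqrtr_ge0. Qed.

Let gibbs_wE X z : gibbs_w alpha gamma n k X z = expR (- (lam * xi gamma n k X z)).
Proof. by rewrite /gibbs_w mulrAC. Qed.

Let w_ge0 X z : 0 <= gibbs_w alpha gamma n k X z. Proof. exact: expR_ge0. Qed.

Lemma gibbs_Z_le1 X : (gibbs_Z alpha gamma n k X <= 1)%E.
Proof.
rewrite -(iter_int_cst R k 1); apply: iter_int_le => z _.
by rewrite lee_fin gibbs_wE -[leRHS]expR0 ler_expR oppr_le0 mulr_ge0 ?lam_ge0 ?xi_ge0.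
Qed.

Let dens_prod_ge0 m (x : nat -> R) : (forall i, 0 <= x i <= 1) ->
  0 <= \prod_(i < m) p (x i).
Proof. by move=> x01; apply: prodr_ge0 => i _; exact: dens_ge0 (x01 i). Qed.

Let dens_prod_le m (x : nat -> R) : (forall i, 0 <= x i <= 1) ->
  \prod_(i < m) p (x i) <= B ^+ m.
Proof.
move=> x01; rewrite -[m in _ ^+ m]card_ord -prodr_const; apply: ler_prod => i _.
by rewrite (dens_ge0 _ (x01 i)) (dens_le_sup _ _ _ _ gamma_ge1 sob).
Qed.

Let B_gt0 : 0 < B. Proof. exact: lt_le_trans ltr01 (sobolev_sup_ge1 _ _). Qed.

(** Markov's inequality in pointwise form: the Gibbs weight is bounded below by [expR (- (lam * r))]
    times [y], which is affine in [risk_bound k z] and at most [1 - xi ^+ 2 / r ^+ 2]. Multiplying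
    by the product of densities over [B ^+ k], at most 1, turns Lebesgue measure into the law of [k]
    draws from [p]. *)
Lemma gibbs_Z_ge X : risk_bound n X <= r ^+ 2 / 8 ->
  2 * (C ^+ 2 + 2) * rate k <= r ^+ 2 / 8 ->
  (((B ^+ k)^-1 * expR (- (lam * r)) / 2)%:E <= gibbs_Z alpha gamma n k X)%E.
Proof.
move=> HX Hk; have [V HV EV] := iter_int_risk_bound k k_gt0.
have r2 : 0 < r ^+ 2 by rewrite exprn_gt0.
have c0 : 0 <= (B ^+ k)^-1 * expR (- (lam * r)).
  by rewrite mulr_ge0 ?expR_ge0// invr_ge0 exprn_ge0// ltW ?B_gt0.
have := EV ((B ^+ k)^-1 * expR (- (lam * r))) (1 - 2 * risk_bound n X / r ^+ 2)
  (- (2 / r ^+ 2)).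
set K := _ * expR _ in c0 *; move=> EK.
(* Both [risk_bound n X] and [V] are at most [r ^+ 2 / 8], so the bracket is at least one half. *)
apply: (@le_trans _ _ (K * (1 - 2 * risk_bound n X / r ^+ 2 + - (2 / r ^+ 2) * V))%:E).
  rewrite lee_fin ler_wpM2l//.
  have -> : 1 - 2 * risk_bound n X / r ^+ 2 + - (2 / r ^+ 2) * V =
    1 - 2 * (risk_bound n X + V) / r ^+ 2 by ring.
  have : 2 * (risk_bound n X + V) / r ^+ 2 <= 2^-1 by rewrite ler_pdivrMr//; lra.
  lra.
rewrite -EK; apply: iter_int_le => z z01; rewrite lee_fin gibbs_wE /K.
have P0 := dens_prod_ge0 k z z01; have P1 := dens_prod_le k z z01.
set P := \prod_(i < k) _ in P0 P1 *; set y := _ + _ * risk_bound k z.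
have -> : (B ^+ k)^-1 * expR (- (lam * r)) * P * y =
  (P / B ^+ k) * (expR (- (lam * r)) * y) by ring.
have PB0 : 0 <= P / B ^+ k by rewrite divr_ge0// exprn_ge0// ltW ?B_gt0.
have PB1 : P / B ^+ k <= 1 by rewrite ler_pdivrMr ?exprn_gt0 ?B_gt0// mul1r.
(* For [y <= 0] the minorant is nonpositive; otherwise [xi <= r] and [y <= 1]. *)
have [y0|y0] := leP y 0.
  apply: (@le_trans _ _ 0); last exact: expR_ge0.
  by rewrite mulr_ge0_le0// mulr_ge0_le0// expR_ge0.
have xi2 : xi gamma n k X z ^+ 2 <= 2 * risk_bound n X + 2 * risk_bound k z.
  rewrite L2distK.
  have := L2sq_le2D _ _ _ _ (continuous_phat n X) continuous_p (continuous_phat k z).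
  rewrite (L2sq_sym _ (phat gamma n X) p).
  have := L2sq_dens_phat n X n_gt0; have := L2sq_dens_phat k z k_gt0; lra.
have yxi : y * r ^+ 2 <= r ^+ 2 - xi gamma n k X z ^+ 2.
  have -> : y * r ^+ 2 = r ^+ 2 - (2 * risk_bound n X + 2 * risk_bound k z).
    by rewrite /y; field; rewrite gt_eqF.
  by rewrite lerB.
have y1 : y <= 1.
  rewrite -(ler_pM2r r2) mul1r; apply: le_trans yxi _.
  by rewrite gerBl sqr_ge0.
have xir : xi gamma n k X z <= r.
  rewrite -(ler_pXn2r (n := 2))// ?nnegrE ?xi_ge0 ?(ltW r_gt0)//.
  have := mulr_gt0 y0 r2; move: yxi; lra.
have e_le : expR (- (lam * r)) * y <= expR (- (lam * xi gamma n k X z)).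
  apply: (@le_trans _ _ (expR (- (lam * r)))).
    by rewrite ler_piMr ?expR_ge0.
  by rewrite ler_expR lerN2 ler_wpM2l ?lam_ge0.
apply: le_trans e_le; rewrite ler_piMl// mulr_ge0 ?expR_ge0//; exact: ltW.
Qed.

Let E := [set z | 16 * r ^+ 2 < L2sq p (phat gamma k z)].

(** On the event, [16 * r ^+ 2 < 2 * (r ^+ 2 / 8) + 2 * xi ^+ 2], which leaves ample room for
    [xi >= 2 * r]. *)
Lemma gibbs_w_tail X z : risk_bound n X <= r ^+ 2 / 8 ->
  \1_E z * gibbs_w alpha gamma n k X z <= expR (- (lam * (2 * r))).
Proof.
move=> HX; rewrite indicE; have [|_] := boolP (z \in E); last first.
  by rewrite mul0r expR_ge0.
rewrite inE /E/= mul1r => Ez; rewrite gibbs_wE ler_expR lerN2 ler_wpM2l ?lam_ge0//.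
rewrite -(ler_pXn2r (n := 2))// ?nnegrE ?xi_ge0 ?mulr_ge0 ?(ltW r_gt0)//.
rewrite L2distK.
have := L2sq_le2D _ _ _ _ continuous_p (continuous_phat n X) (continuous_phat k z).
have := L2sq_dens_phat n X n_gt0; have := sqr_ge0 r; rewrite exprMn; lra.
Qed.

(** The first term handles samples [X] of small risk. For the others the second term exceeds 1 and
    the bound is trivial. Their sum is affine in [risk_bound], so it can be averaged over [X]
    without splitting the integral. *)
Lemma gibbs_cond_prob_le X : 2 * (C ^+ 2 + 2) * rate k <= r ^+ 2 / 8 ->
  (iter_int k (fun z => (\1_E z * gibbs_w alpha gamma n k X z)%:E)
   / gibbs_Z alpha gamma n k X <=
   (2 * B ^+ k * expR (- (lam * r)) + 8 / r ^+ 2 * risk_bound n X)%:E)%E.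
Proof.
move=> Hk; set num := iter_int k _; set Z := gibbs_Z _ _ _ _ _.
have r2 : 0 < r ^+ 2 by rewrite exprn_gt0.
have iZ (z : nat -> R) : 0 <= \1_E z * gibbs_w alpha gamma n k X z
    <= gibbs_w alpha gamma n k X z.
  rewrite indicE; case: (_ \in _); rewrite ?mul1r ?mul0r ?w_ge0 ?lexx//.
have num0 : (0 <= num)%E.
  apply: (@le_trans _ _ (iter_int k (fun=> 0%:E))); first by rewrite iter_int_cst.
  apply: iter_int_le => z _.
  by rewrite lee_fin; case/andP: (iZ z).
have numZ : (num <= Z)%E.
  by apply: iter_int_le => z _; rewrite lee_fin; case/andP: (iZ z).
have Z1 : (Z <= 1)%E := gibbs_Z_le1 X.
have eta0 : 0 <= 2 * B ^+ k * expR (- (lam * r)).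
  by rewrite !mulr_ge0 ?expR_ge0 ?exprn_ge0// ltW ?B_gt0.
have risk0 : 0 <= risk_bound n X.
  rewrite addr_ge0//; last by rewrite mulr_ge0// sumr_ge0// => j _; exact: sqr_ge0.
  by rewrite mulr_ge0// mulr_ge0 ?sqr_ge0 ?powR_ge0.
have num1 : (num <= 1)%E := le_trans numZ Z1.
have finZ : Z \is a fin_num.
  by rewrite ge0_fin_numE ?(le_trans num0 numZ)//; exact: le_lt_trans Z1 (ltry 1).
have finnum : num \is a fin_num.
  by rewrite ge0_fin_numE//; exact: le_lt_trans num1 (ltry 1).
(* A nonzero numerator forces [Z > 0], since [num <= Z]; the quotient of extended reals then becomes
   a real one. *)
have [num_eq0|num_neq0] := eqVneq num 0%E.
  by rewrite num_eq0 mul0e lee_fin addr_ge0// mulr_ge0// divr_ge0// ltW.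
have Z_gt0 : 0 < fine Z.
  rewrite -lte_fin fineK//; apply: lt_le_trans numZ.
  by rewrite lt_neqAle eq_sym num_neq0.
rewrite -(fineK finZ) -(fineK finnum) inver gt_eqF// -EFinM lee_fin.
have [HX|HX] := leP (risk_bound n X) (r ^+ 2 / 8); last first.
  apply: (@le_trans _ _ 1).
    by rewrite ler_pdivrMr// mul1r; apply: fine_le.
  rewrite -[leLHS]add0r lerD//.
  rewrite mulrAC -(mulrC (risk_bound n X)) mulrC ler_pdivlMr// mul1r; move: HX; lra.
rewrite ler_pdivrMr//; apply: (@le_trans _ _ (2 * B ^+ k * expR (- (lam * r)) * fine Z));
  last first.
  by rewrite ler_wpM2r ?(ltW Z_gt0)// lerDl mulr_ge0// divr_ge0// ltW.
have HZ := gibbs_Z_ge X HX Hk; rewrite -/Z -(fineK finZ) lee_fin in HZ.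
have : (num <= (expR (- (lam * (2 * r))))%:E)%E.
  rewrite -(iter_int_cst R k); apply: iter_int_le => z _.
  by rewrite lee_fin gibbs_w_tail.
rewrite -{1}(fineK finnum) lee_fin => /le_trans; apply.
have -> : - (lam * (2 * r)) = - (lam * r) + - (lam * r) by ring.
rewrite expRD.
have Bk : 0 < B ^+ k by rewrite exprn_gt0 ?B_gt0.
(* The last factor is exactly the lower bound [HZ] for the normalising constant. *)
have -> : expR (- (lam * r)) * expR (- (lam * r)) =
  2 * B ^+ k * expR (- (lam * r)) * ((B ^+ k)^-1 * expR (- (lam * r)) / 2).
  by field; rewrite gt_eqF.
by rewrite ler_wpM2l.
Qed.

Lemma joint_prob_le : 2 * (C ^+ 2 + 2) * rate k <= r ^+ 2 / 8 ->
  (joint_prob p alpha gamma n k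
     (fun _ z => 16 * r ^+ 2 < L2sq p (phat gamma k z))%R <=
   (2 * B ^+ k * expR (- (lam * r)) +
    8 / r ^+ 2 * (2 * (C ^+ 2 + 2) * rate n))%:E)%E.
Proof.
move=> Hk; have [V HV EV] := iter_int_risk_bound n n_gt0.
apply: (@le_trans _ _ (2 * B ^+ k * expR (- (lam * r)) + 8 / r ^+ 2 * V)%:E);
  last first.
  by rewrite lee_fin lerD2l ler_wpM2l// divr_ge0// sqr_ge0.
rewrite -[X in X%:E]mul1r -EV; apply: iter_int_le => X X01.
rewrite mul1r EFinM -muleA; apply: lee_wpmul2l.
  by rewrite lee_fin dens_prod_ge0.
exact: gibbs_cond_prob_le.
Qed.

End GibbsSampling.

(** * Powers of [n], expressed through [q]: the rate of the theorem is [q ^+ 2] and [rate n] is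
    [q ^+ 4] *)

Section Rates.
Variables (R : realType) (gamma alpha : R) (n : nat).
Hypotheses (gamma_ge1 : 1 <= gamma) (alpha_ge0 : 0 <= alpha) (n_gt0 : (0 < n)%N).
Local Notation kappa := (gamma / (2 * gamma + 1)).
Local Notation q := (n%:R `^ (- (kappa / 2)) : R).

Let kappa_ge0 : 0 <= kappa.
Proof. by rewrite divr_ge0//; move: gamma_ge1; lra. Qed.

Let n_gt0R : 0 < n%:R :> R. Proof. by rewrite ltr0n. Qed.

Let n_ge1R : 1 <= n%:R :> R. Proof. by rewrite ler1n. Qed.

Lemma powR_kappa : n%:R `^ (- kappa) = q ^+ 2.
Proof.
rewrite -powR_mulrn ?powR_ge0// -powRrM; congr (_ `^ _).
by field; move: gamma_ge1; lra.
Qed.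

Lemma rate_kappa : rate R gamma n = q ^+ 4.
Proof.
rewrite -powR_mulrn ?powR_ge0// -powRrM; congr (_ `^ _).
by field; move: gamma_ge1; lra.
Qed.

Lemma powR_kappa_le1 : q <= 1.
Proof.
rewrite -[leRHS](powRr0 n%:R); apply: ler_powR => //.
by rewrite oppr_le0; move: kappa_ge0; lra.
Qed.

(* 3 kappa / 2 >= 1 / 2 amounts to gamma >= 1. *)
Lemma sqrt_le_powR_kappa : Num.sqrt n%:R <= q ^- 3.
Proof.
rewrite -powR12_sqrt ?ler0n// -powR_mulrn ?powR_ge0// -powRrM -powRN.
apply: ler_powR => //.
have -> : - (- (kappa / 2) * 3%:R) = (3 * gamma) / (2 * (2 * gamma + 1)).
  by field; move: gamma_ge1; lra.
by rewrite ler_pdivlMr; move: gamma_ge1; lra.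
Qed.

(** Since [c0 ^+ 2 = 2], [Delta] is at most [4 * q ^+ 4]; with radius [L * q / 4] the exponent is at
    least a multiple of [q ^- 3], hence of [sqrt n]. *)
Lemma gibbs_exponent_ge (L : R) : 0 <= L ->
  alpha * L / 32 * Num.sqrt n%:R <= alpha / (2 * Delta gamma n) * (L * q / 4).
Proof.
move=> L0; have q0 : 0 < q by rewrite powR_gt0.
(* A positive truncation index makes [Delta] positive, as is required to invert its upper bound. *)
have m1 : (1 <= mtrunc gamma n)%N.
  rewrite truncn_gt0 -[leLHS](powRr0 n%:R); apply: ler_powR => //.
  by rewrite divr_ge0//; move: gamma_ge1; lra.
have Delta0 : 0 < Delta gamma n.
  have c0_gt0 : 0 < c0 R by rewrite sqrtr_gt0.
  by rewrite /Delta divr_gt0 ?mulr_gt0 ?ltr0n.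
have Delta_le : Delta gamma n <= 4 * q ^+ 4.
  have := mtrunc_div_le _ _ gamma_ge1 n n_gt0; rewrite rate_kappa /Delta /c0.
  rewrite sqr_sqrtr// -mulrA; lra.
apply: (@le_trans _ _ (alpha / (2 * (4 * q ^+ 4)) * (L * q / 4))); last first.
  apply: ler_wpM2r; first by rewrite divr_ge0// mulr_ge0// ltW.
  have d1 : 0 < 2 * Delta gamma n by rewrite mulr_gt0.
  have d2 : 0 < 2 * (4 * q ^+ 4) by rewrite mulr_gt0// mulr_gt0// exprn_gt0.
  by rewrite ler_wpM2l// lef_pV2 ?posrE// ler_pM2l.
have -> : alpha / (2 * (4 * q ^+ 4)) * (L * q / 4) = alpha * L / 32 * q ^- 3.
  by field; rewrite gt_eqF.
rewrite ler_wpM2l ?sqrt_le_powR_kappa// divr_ge0// mulr_ge0//.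
Qed.

(** [rate] decreases with the sample size, and at [sqrt n] it equals [q ^+ 2]: the smaller sample
    size [k] dictates the final rate. *)
Lemma rate_sqrt_le (k : nat) (c : R) : 0 < c -> c * Num.sqrt n%:R <= k%:R ->
  rate R gamma k <= c `^ (- (2 * kappa)) * q ^+ 2.
Proof.
move=> c0 ck; have cs0 : 0 < c * Num.sqrt n%:R by rewrite mulr_gt0// sqrtr_gt0.
have -> : c `^ (- (2 * kappa)) * q ^+ 2 = (c * Num.sqrt n%:R) `^ (- (2 * kappa)).
  rewrite powRM ?(ltW c0) ?sqrtr_ge0//; congr (_ * _).
  rewrite -powR_kappa -powR12_sqrt ?ler0n// -powRrM; congr (_ `^ _).
  by field; move: gamma_ge1; lra.
rewrite /rate -mulrA !powRN lef_pV2 ?posrE ?powR_gt0//; last exact: lt_le_trans ck.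
have g2 : 0 <= 2 * kappa by rewrite mulr_ge0.
apply: ge0_ler_powR; rewrite ?nnegrE ?ler0n ?(ltW cs0)//.
Qed.

End Rates.

(** * Choice of constants and conclusion *)

Theorem mainTheorem12 (R : realType) (gamma C alpha : R) (beta : nat -> R)
  (kseq : nat -> nat) :
  1 < gamma -> 0 < C -> 0 < alpha ->
  in_sobolev gamma C beta ->
  (forall x : R, 0 <= x <= 1 -> 0 <= dens beta x) ->
  (exists c1 c2 : R, exists N0 : nat, 0 < c1 /\ 0 < c2 /\
     forall n : nat, (N0 <= n)%N ->
       c1 * Num.sqrt n%:R <= (kseq n)%:R <= c2 * Num.sqrt n%:R) ->
  forall eps : R, 0 < eps ->
  exists M : R, 0 < M /\ exists N : nat, forall n : nat, (N <= n)%N ->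
    (joint_prob (dens beta) alpha gamma n (kseq n)
       (fun X Z => M * n%:R `^ (- (gamma / (2 * gamma + 1)))
                   < L2sq (dens beta) (phat gamma (kseq n) Z))%R
     <= eps%:E)%E.
Proof.
move=> g1 _ a0 sob p0 [c1 [c2 [N0 [c10 [c20 kn]]]]] eps e0.
have g1' := ltW g1; have B1 := sobolev_sup_ge1 R C.
set B := sobolev_sup R C in B1.
have lnB0 : 0 <= ln B by rewrite ln_ge0.
pose A := C ^+ 2 + 2; pose D := c1 `^ (- (2 * (gamma / (2 * gamma + 1)))).
have A0 : 0 < A by rewrite ltr_wpDl ?sqr_ge0.
have D0 : 0 <= D by rewrite powR_ge0.
(* The bounds serve in turn: [L <= L ^+ 2], the condition [Hk] on the [k]-sample, the averaged risk
   [H1], and the domination of [B ^+ k] by the Gibbs exponent in [H2]. *)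
have [L [L1 L2 L3 L4]] : exists L, [/\ 1 <= L, 256 * A * D <= L, 512 * A / eps <= L
    & 32 * (c2 * ln B + 1) / alpha <= L].
  have h1 : 0 <= 256 * A * D.
    by apply: mulr_ge0 => //; apply: mulr_ge0; [exact: ler0n|exact: ltW].
  have h2 : 0 <= 512 * A / eps.
    by apply: divr_ge0; [apply: mulr_ge0; [exact: ler0n|exact: ltW]|exact: ltW].
  have h3 : 0 <= 32 * (c2 * ln B + 1) / alpha.
    by rewrite divr_ge0 ?(ltW a0)// mulr_ge0// addr_ge0// mulr_ge0// ltW.
  exists (1 + 256 * A * D + 512 * A / eps + 32 * (c2 * ln B + 1) / alpha).
  by split; lra.
have L0 : 0 < L by lra.
(* With [r = L * q / 4], the threshold [16 * r ^+ 2] is [L ^+ 2] times the rate. *)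
exists (L ^+ 2); split; first by rewrite exprn_gt0.
(* The last entry forces [sqrt n >= 4 / eps], from which [2 * expR (- sqrt n) <= eps / 2]. *)
exists (maxn N0 (maxn 1 (Num.truncn ((4 / eps) ^+ 2)).+1)) => n.
rewrite !geq_max => /and3P[/kn/andP[k1 k2] n0 nlarge].
have n0R : 0 < n%:R :> R by rewrite ltr0n.
have k0 : (0 < kseq n)%N.
  by rewrite -(ltr0n R); apply: lt_le_trans k1; rewrite mulr_gt0// sqrtr_gt0.
have sqrtn : 4 / eps <= Num.sqrt n%:R.
  rewrite -(ler_pXn2r (n := 2))// ?nnegrE ?sqrtr_ge0 ?divr_ge0 ?(ltW e0)//.
  rewrite sqr_sqrtr ?ler0n//.
  have /andP[_ /ltW/le_trans] := truncn_itv (sqr_ge0 (4 / eps)).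
  by apply; rewrite ler_nat.
rewrite powR_kappa//; set q := _ `^ _; set k := kseq n in k0 k1 k2 *.
have q0 : 0 < q by rewrite powR_gt0.
have q1 : q <= 1 := powR_kappa_le1 _ _ _ g1' n0.
have LL : L <= L ^+ 2 by rewrite expr2 ler_pMl.
have Hk : 2 * A * rate R gamma k <= (L * q / 4) ^+ 2 / 8.
  apply: (@le_trans _ _ (2 * A * (D * q ^+ 2))).
    rewrite ler_wpM2l ?mulr_ge0 ?(ltW A0)//.
    exact: rate_sqrt_le.
  have -> : (L * q / 4) ^+ 2 / 8 = L ^+ 2 / 128 * q ^+ 2 by field.
  rewrite [leLHS]mulrA ler_wpM2r ?sqr_ge0//; lra.
have r0 : 0 < L * q / 4 by rewrite divr_gt0// mulr_gt0.
have := joint_prob_le _ _ _ _ _ g1' (ltW a0) sob p0 _ _ _ n0 k0 r0 Hk.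
rewrite -/B -/A; have -> : 16 * (L * q / 4) ^+ 2 = L ^+ 2 * q ^+ 2 by field.
move=> /le_trans; apply; rewrite lee_fin.
have H1 : 8 / (L * q / 4) ^+ 2 * (2 * A * rate R gamma n) <= eps / 2.
  rewrite rate_kappa// -/q.
  have -> : 8 / (L * q / 4) ^+ 2 * (2 * A * q ^+ 4) = 256 * A * q ^+ 2 / L ^+ 2.
    by field; rewrite !gt_eqF.
  rewrite ler_pdivrMr ?exprn_gt0//; apply: (@le_trans _ _ (256 * A)).
    apply: ler_piMr; first by apply: mulr_ge0; [exact: ler0n|exact: ltW].
    by rewrite exprn_ile1// ltW.
  move: L3; rewrite ler_pdivrMr// => L3.
  have : L * eps <= L ^+ 2 * eps by rewrite ler_wpM2r// ltW.
  lra.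
(* [B ^+ k] is at most [expR (c2 * ln B * sqrt n)], while the Gibbs exponent is at least
   [(c2 * ln B + 1) * sqrt n]; the surplus [sqrt n] remains. *)
have H2 : 2 * B ^+ k * expR (- (alpha / (2 * Delta gamma n) * (L * q / 4))) <= eps / 2.
  have -> : B ^+ k = expR (k%:R * ln B) by rewrite expRM_natl lnK// posrE; lra.
  rewrite -mulrA -expRD.
  have kB : k%:R * ln B <= c2 * Num.sqrt n%:R * ln B by rewrite ler_wpM2r.
  have LB : (c2 * ln B + 1) * Num.sqrt n%:R <= alpha * L / 32 * Num.sqrt n%:R.
    rewrite ler_wpM2r ?sqrtr_ge0//; move: L4; rewrite ler_pdivrMr//; lra.
  have EL := gibbs_exponent_ge _ _ _ _ g1' (ltW a0) n0 L (ltW L0).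
  rewrite -/q in EL.
  apply: (@le_trans _ _ (2 * expR (- Num.sqrt n%:R))).
    rewrite ler_wpM2l// ler_expR; lra.
  rewrite expRN; have := expR_ge1Dx (Num.sqrt n%:R : R).
  move=> /(le_trans _) H; have {}H : 4 / eps <= expR (Num.sqrt n%:R).
    by apply: H; lra.
  rewrite ler_pdivrMr ?expR_gt0//; move: H; rewrite ler_pdivrMr//; lra.
lra.
Qed.
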